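(* Suppose that the mesh-refinement strategy satisfies (M1). Then there exists a modified mesh-size function $\widetilde h:[\mathbb T]\to L^\infty(\Gamma)$ with the following properties. There exist constants $C_{\rm wt}>0$ and $0<q_{\rm ctr}<1$, which depend only on $\check\kappa_{\max}$, $p$ and $\gamma$, such that for all $[\mathcal T_\star]\in[\mathbb T]$ and all refinements $[\mathcal T_+]\in\mathtt{ref}([\mathcal T_\star])$ the corresponding mesh-sizes $\widetilde h_\star:=\widetilde h([\mathcal T_\star])$ and $\widetilde h_+:=\widetilde h([\mathcal T_+])$ satisfy (as inequalities of functions in $L^\infty(\Gamma)$) equivalence $$C_{\rm wt}^{-1}\,\check h_\star\le\widetilde h_\star\le C_{\rm wt}\,\check h_\star ,$$ reduction $$\widetilde h_+\le\widetilde h_\star ,$$ and contraction on the patch of refined elements $$\widetilde h_+|_{\omega_+([\mathcal T_+]\setminus[\mathcal T_\star])}\le q_{\rm ctr}\,\widetilde h_\star|_{\omega_+([\mathcal T_+]\setminus[\mathcal T_\star])} .$$ Moreover, $\omega_+([\mathcal T_+]\setminus[\mathcal T_\star])=\omega_\star([\mathcal T_\star]\setminus[\mathcal T_+])$.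
   Context: **Boundary.** $\Omega\subset\mathbb{R}^2$ is a Lipschitz domain with $\mathrm{diam}(\Omega)<1$ and $\Gamma\subseteq\partial\Omega$ is a compact, connected, piecewise smooth part of its boundary. Either $\Gamma=\partial\Omega$ (''closed'') is parametrized by a closed, continuous, piecewise twice continuously differentiable path $\gamma:[a,b]\to\Gamma$ with $\gamma|_{[a,b)}$ bijective (its $(b-a)$-periodic extension is also called $\gamma$), or $\Gamma\subsetneqq\partial\Omega$ (''open'') is parametrized by a bijective, continuous, piecewise twice continuously differentiable path $\gamma:[a,b]\to\Gamma$. The one-sided derivatives satisfy $\gamma'^{\ell}(t)\ne0$ on $(a,b]$, $\gamma'^{r}(t)\neq0$ on $[a,b)$, and $\gamma'^{\ell}(t)+c\,\gamma'^{r}(t)\ne0$ for all $c>0$ and all $t\in[a,b]$ (closed) resp. $t\in(a,b)$ (open). $|\cdot|$ denotes length of intervals and arclength. **Meshes.** Fix $p\in\mathbb{N}_0$. A mesh $[\mathcal T_\star]$ consists of parameters $a=\check z_0<\dots<\check z_n=b$ with $\gamma|_{[\check z_{j-1},\check z_j]}\in C^2$, nodes $z_j=\gamma(\check z_j)$ (node set $\mathcal N_\star=\{z_1,\dots,z_n\}$, $z_0=z_n$, if closed; $\mathcal N_\star=\{z_0,\dots,z_n\}$ if open), and multiplicities $\#z_j\in\{1,\dots,p+1\}$ with $\#z_0=\#z_n=p+1$. The knots $\mathcal K_\star$ are the tuple $(z_k,\dots,z_k,\dots,z_n,\dots,z_n)$, each $z_j$ repeated $\#z_j$ times, $k=1$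 (closed) resp. $k=0$ (open). The elements are $T_j=\gamma([\check z_{j-1},\check z_j])$, $\mathcal T_\star=\{T_1,\dots,T_n\}$, $[T]:=(T,\#z_{T,1},\#z_{T,2})$ with $z_{T,1},z_{T,2}$ the two end nodes of $T$, and $[\mathcal T_\star]=\{[T]:T\in\mathcal T_\star\}$. Put $\check h_{\star,T}=|\gamma^{-1}(T)|$ and let $\check h_\star\in L^\infty(\Gamma)$ with $\check h_\star|_T=\check h_{\star,T}$; $\check\kappa_\star=\max\{\check h_{\star,T}/\check h_{\star,T'}:T,T'\in\mathcal T_\star,\ T\cap T'\ne\emptyset\}$. For $U\subseteq\Gamma$, $\omega_\star(U)=\bigcup\{T\in\mathcal T_\star:T\cap U\ne\emptyset\}$. For a set $\mathcal U$ of triples $[T]$ from $[\mathcal T_\star]$, $\bigcup\mathcal U=\bigcup\{T:[T]\in\mathcal U\}$ and $\omega_\star(\mathcal U)=\omega_\star(\bigcup\mathcal U)$; $\omega_+$ is defined analogously with $\mathcal T_+$. **Refinement.** $\mathtt{ref}(\cdot)$ is a deterministic strategy assigning to a mesh $[\mathcal T_\star]$ and a set $\mathcal M_\star\subseteq\mathcal N_\star$ of marked nodes a mesh $[\mathcal T_+]=\mathtt{ref}([\mathcal T_\star],\mathcal M_\star)$ such that $\mathcal M_\star\subset\bigcup([\mathcal T_\star]\setminus[\mathcal T_+])$ and $\mathcal K_\star$ is a subsequence of $\mathcal K_+$. $\mathtt{ref}([\mathcal T_\star])$ is the set of all meshes obtained from $[\mathcal T_\star]$ by finitely many (possibly zero)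 such steps with arbitrary marked sets. Fix an initial mesh $[\mathcal T_0]$ (with $|T|\le|\Gamma|/4$ for all $T\in\mathcal T_0$ if $\Gamma$ is closed) and put $[\mathbb T]=\mathtt{ref}([\mathcal T_0])$. Assumption (M1): there is $\check\kappa_{\max}\ge1$ with $\check\kappa_\star\le\check\kappa_{\max}$ for all $[\mathcal T_\star]\in[\mathbb T]$. *)

(* Defs.v *)
From HB Require Import structures.
From mathcomp Require Import all_boot all_order all_algebra.
From mathcomp Require Import all_classical all_reals all_analysis.
From mathcomp Require Import measurable_realfun.

Set Implicit Arguments.
Unset Strict Implicit.
Unset Printing Implicit Defensive.
Import Order.TTheory GRing.Theory Num.Theory.
Import numFieldNormedType.Exports.

Local Open Scope classical_set_scope.
Local Open Scope ring_scope.

(* The library norm and uniform structure of a product are those of the max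
   norm; Euclidean lengths are taken with [enorm]. *)
Definition plane (R : realType) := (measurableTypeR R * measurableTypeR R)%type.

Definition enorm (R : realType) (v : plane R) : R :=
  Num.sqrt (v.1 ^+ 2 + v.2 ^+ 2).

Definition ediam (R : realType) (A : set (plane R)) : \bar R :=
  ereal_sup [set (enorm (x.1 - x.2))%:E | x in A `*` A].

Definition boundary (T : topologicalType) (A : set T) : set T :=
  closure A `\` interior A.

(* Near each boundary point, after a translation by [x] and a rotation with
   axes [(c, s)] and [(- s, c)], the domain is the strict epigraph of a
   Lipschitz function. *)
Definition lipschitz_domain (R : realType) (Omega : set (plane R)) : Prop :=
  [/\ open Omega, connected Omega, Omega !=set0 &
      forall x, boundary Omega x ->
        exists (c s : R) (phi : R -> R),
          [/\ c ^+ 2 + s ^+ 2 = 1, lipschitz phi &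
              \forall y \near x,
                Omega y <->
                phi (c * (y.1 - x.1) + s * (y.2 - x.2)) <
                  - s * (y.1 - x.1) + c * (y.2 - x.2)]].

(* [f'] is the derivative of [f] relative to [A]: one-sided at the end points
   if [A] is a compact interval. *)
Definition has_derivative_on (R : realType) (V : normedModType R) (A : set R)
    (f f' : R -> V) : Prop :=
  forall t, A t ->
    h^-1 *: (f (h + t) - f t) @[h --> within [set h | A (h + t)] 0^'] --> f' t.

Definition C2_on (R : realType) (V : normedModType R) (A : set R)
    (f : R -> V) : Prop :=
  exists f1 f2 : R -> V,
    [/\ has_derivative_on A f f1, has_derivative_on A f1 f2 &
        {within A, continuous f2}].

Definition lderive (R : realType) (V : normedModType R) (f : R -> V) (t : R) : V :=
  lim (h^-1 *: (f (h + t) - f t) @[h --> 0^'-]).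

Definition rderive (R : realType) (V : normedModType R) (f : R -> V) (t : R) : V :=
  lim (h^-1 *: (f (h + t) - f t) @[h --> 0^'+]).

Definition piecewise_C2 (R : realType) (V : normedModType R) (a b : R)
    (f : R -> V) : Prop :=
  exists s : seq R, itv_partition a b s /\
    forall i, (i < size s)%N ->
      C2_on `[nth b (a :: s) i, nth b (a :: s) i.+1] f.

(* The path [gamma : [a, b] -> R^2]; it is a total function of which only the
   values on [`[a, b]] matter, except for closed paths, where it is the
   [(b - a)]-periodic extension (see [boundary_setting]). *)
Record pwC2_path (R : realType) := PwC2Path {
  start : R;
  stop : R;
  path_fun :> R -> plane R;
  start_lt_stop : start < stop;
  path_continuous : {within `[start, stop], continuous path_fun};
  path_piecewise_C2 : piecewise_C2 start stop path_fun }.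

(* Arclength measure of [gamma], as a Borel measure on the plane concentrated
   on the trace of [gamma].  At the finitely many break points of [gamma] the
   value of [derive1 gamma] is irrelevant. *)
Definition arclength (R : realType) (gamma : pwC2_path R) (A : set (plane R)) :
    \bar R :=
  \int[lebesgue_measure]_(t in `[start gamma, stop gamma] `&` gamma @^-1` A)
    (enorm (derive1 gamma t))%:E.

Section arclength_measure.
Context (R : realType).
Implicit Types gamma : pwC2_path R.

Lemma has_derivative_oo (V : normedModType R) (c d t : R) (f f' : R -> V) :
  has_derivative_on `[c, d] f f' -> c < t < d ->
  h^-1 *: (f (h + t) - f t) @[h --> 0^'] --> f' t.
Proof.
move=> ff' /andP[ct td].
have tcd : `[c, d]%classic t by rewrite /= in_itv /= !ltW.
apply: cvg_trans (ff' _ tcd); apply: cvg_app => B.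
move=> /= HB.
have e0 : 0 < Num.min (t - c) (d - t) by rewrite lt_min !subr_gt0 ct.
have cd : \forall h \near (0 : R)^', `[c, d]%classic (h + t).
  near=> h; rewrite /= in_itv /=.
  have : `|h| < Num.min (t - c) (d - t) by near: h; exact: dnbhs0_lt.
  rewrite lt_min !ltr_norml => /andP[/andP[h1 _] /andP[_ h2]].
  by rewrite -lerBlDr -[X in _ && X]lerBrDr (ltW h2) andbT -opprB ltW.
by apply: (@filterS2 _ (0 : R)^' _ _ _ _ _ HB cd) => h; apply.
Unshelve. all: by end_near. Qed.

Lemma C2_measurable_speed (c d : R) (f : R -> plane R) : C2_on `[c, d] f ->
  measurable_fun (`]c, d[ : set (measurableTypeR R))
    (fun t => enorm (derive1 f t)).
Proof.
move=> [f1 [f2 [ff1 f1f2 _]]].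
have E t : t \in `]c, d[%classic -> derive1 f t = f1 t.
  rewrite inE /= in_itv /= => tcd.
  exact: cvg_lim (has_derivative_oo ff1 tcd).
have cf1 t : t \in `]c, d[%classic -> {for t, continuous f1}.
  rewrite inE /= in_itv /= => tcd.
  apply: differentiable_continuous; apply/derivable1_diffP.
  rewrite /derivable; apply/cvg_ex; exists (f2 t).
  have := has_derivative_oo f1f2 tcd.
  apply: cvg_trans; apply: near_eq_cvg; near=> h.
  by rewrite /= /GRing.scale /= mulr1.
apply: (eq_measurable_fun (fun t => enorm (f1 t))).
  by move=> t /E ->.
apply: (@measurableT_comp _ _ _ _ _ _ (@Num.sqrt R)).
  exact: continuous_measurable_fun (@sqrt_continuous R).
apply: measurable_funD; apply: (@measurableT_comp _ _ _ _ _ _ (fun x : R => x ^+ 2)) => //;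
  apply: open_continuous_measurable_fun; rewrite ?interval_open//= => t /cf1 ct.
- exact: (cvg_comp _ _ ct (@cvg_fst _ _ _ _ _)).
- exact: (cvg_comp _ _ ct (@cvg_snd _ _ _ _ _)).
Unshelve. all: by end_near. Qed.

Lemma measurable_speed gamma :
  measurable_fun (`[start gamma, stop gamma] : set (measurableTypeR R))
    (fun t => enorm (derive1 gamma t)).
Proof.
have [s [ps C2s]] := path_piecewise_C2 gamma.
elim: s (start gamma) ps C2s => [|x s IH] a ps C2s.
  by rewrite (itv_partition_nil ps) set_itv1; exact: measurable_fun_set1.
have ax : a < x by case: ps => /= /andP[].
have pxs := itv_partition_cons ps.
have xb := itv_partition_le pxs.
have -> : `[a, stop gamma]%classic = `[a, x] `|` `[x, stop gamma] :> set R.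
  rewrite predeqE => t; rewrite /= !in_itv /=; split.
    by move=> /andP[at_ tb]; case: (lerP t x) => xt; [left|right];
      rewrite ?at_ ?tb ?xt ?(ltW xt).
  move=> [|] /andP[h1 h2]; rewrite ?h1 ?h2 ?andbT /=.
    exact: le_trans xb.
  exact: le_trans (ltW ax) h1.
apply/measurable_funU; try exact: measurable_itv.
split; last first.
  by apply: IH => // i ilt; have := C2s i.+1; apply.
by apply: measurable_fun_itv_cc; apply: C2_measurable_speed; have := C2s 0%N; apply.
Qed.

Lemma measurable_path gamma :
  measurable_fun (`[start gamma, stop gamma] : set (measurableTypeR R)) gamma.
Proof.
set D := (D in measurable_fun D _).
have mD : measurable D by exact: measurable_itv.
have m1 : measurable_fun D (fst \o gamma).
  apply: subspace_continuous_measurable_fun => // t.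
  exact: (cvg_comp _ _ (@path_continuous _ gamma t) (@cvg_fst _ _ _ _ _)).
have m2 : measurable_fun D (snd \o gamma).
  apply: subspace_continuous_measurable_fun => // t.
  exact: (cvg_comp _ _ (@path_continuous _ gamma t) (@cvg_snd _ _ _ _ _)).
apply: (eq_measurable_fun
  (fun t => (((fst \o gamma) \_ D) t, ((snd \o gamma) \_ D) t) : plane R)).
  by move=> t tD; rewrite !patchE tD /=; case: (gamma t).
by apply: measurable_funTS; apply: measurable_fun_pair;
  apply/(measurable_restrictT _ _).1.
Qed.

Let arclength0 gamma : arclength gamma set0 = 0%E.
Proof. by rewrite /arclength preimage_set0 setI0 integral_set0. Qed.

Let arclength_ge0 gamma A : (0 <= arclength gamma A)%E.
Proof. by apply: integral_ge0 => t _; rewrite lee_fin sqrtr_ge0. Qed.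

Let arclength_sigma_additive gamma : semi_sigma_additive (arclength gamma).
Proof.
move=> F mF tF mUF; rewrite /arclength preimage_bigcup setI_bigcupr.
have mE : measurable_fun
    (\bigcup_i (`[start gamma, stop gamma] `&` gamma @^-1` F i) :
      set (measurableTypeR R))
    (fun t => (enorm (derive1 gamma t))%:E).
  have mI : measurable (`[start gamma, stop gamma] : set (measurableTypeR R)).
    exact: measurable_itv.
  have /measurable_EFinP := @measurable_speed gamma.
  by apply: (measurable_funS mI) => t [k _ []].
rewrite (ge0_integral_bigcup _ _ mE).
- by apply: is_cvg_ereal_nneg_natsum_cond => n _ _; exact: arclength_ge0.
- by move=> k; apply: measurable_path; first exact: measurable_itv; exact: mF.
- by move=> t _; rewrite lee_fin sqrtr_ge0.
- by move=> i j Di Dj [t [[_ Fi] [_ Fj]]]; apply: tF => //; exists (gamma t).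
Qed.

HB.instance Definition _ gamma := isMeasure.Build _ _ _ (arclength gamma)
  (arclength0 gamma) (arclength_ge0 gamma)
  (@arclength_sigma_additive gamma).

End arclength_measure.

(* L^oo(Gamma): classes of essentially bounded Borel functions on the plane
   modulo equality arclength-almost everywhere; [arclength gamma] does not
   charge the complement of the trace of [gamma]. *)
Definition Linfty (R : realType) (gamma : pwC2_path R) : Type :=
  LspaceType (arclength gamma) (leey 1).

(* [cl] distinguishes closed ([cl = true]) from open ([cl = false]) Gamma. *)
Record boundary_setting (R : realType) (cl : bool) (Omega Gamma : set (plane R))
    (gamma : pwC2_path R) : Prop := BoundarySetting {
  setting_lipschitz : lipschitz_domain Omega;
  setting_diam : (ediam Omega < 1)%E;
  setting_sub : Gamma `<=` boundary Omega;
  setting_compact : compact Gamma;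
  setting_connected : connected Gamma;
  setting_closed : cl ->
    [/\ Gamma = boundary Omega,
        forall t, gamma (t + (stop gamma - start gamma)) = gamma t &
        set_bij `[start gamma, stop gamma[ Gamma gamma];
  setting_open : ~~ cl ->
    Gamma <> boundary Omega /\ set_bij `[start gamma, stop gamma] Gamma gamma;
  setting_lderive : forall t, start gamma < t <= stop gamma ->
    lderive gamma t != 0;
  setting_rderive : forall t, start gamma <= t < stop gamma ->
    rderive gamma t != 0;
  setting_no_cusp : forall c t, 0 < c ->
    (if cl then start gamma <= t <= stop gamma
     else start gamma < t < stop gamma) ->
    lderive gamma t + c *: rderive gamma t != 0 }.

(* [breaks] lists the parameters of z_1, ..., z_n (the parameter of z_0 being
   [start gamma]) and [mults] the multiplicities of z_0, ..., z_n. *)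
Record mesh (R : realType) (gamma : pwC2_path R) (p : nat) := Mesh {
  breaks : seq R;
  mults : seq nat;
  mesh_partition : itv_partition (start gamma) (stop gamma) breaks;
  mesh_C2 : forall j, (j < size breaks)%N ->
    C2_on `[nth (stop gamma) (start gamma :: breaks) j,
            nth (stop gamma) (start gamma :: breaks) j.+1] gamma;
  mesh_size_mults : size mults = (size breaks).+1;
  mesh_mults : all (fun k => 0 < k <= p.+1)%N mults;
  mesh_mult_first : nth 0%N mults 0 = p.+1;
  mesh_mult_last : nth 0%N mults (size breaks) = p.+1 }.

Section mesh_theory.
Context (R : realType) (gamma : pwC2_path R) (p : nat).
Implicit Types (m : mesh gamma p) (cl : bool) (T U : set (plane R)).

Definition nb_elements m : nat := size (breaks m).

Definition node_param m (j : nat) : R :=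
  nth (stop gamma) (start gamma :: breaks m) j.

Definition node m (j : nat) : plane R := gamma (node_param m j).

Definition node_mult m (j : nat) : nat := nth 0%N (mults m) j.

Definition first_index cl : nat := if cl then 1 else 0.

Definition nodes cl m : set (plane R) :=
  [set node m j | j in [set j | (first_index cl <= j <= nb_elements m)%N]].

Definition knots cl m : seq (plane R) :=
  flatten [seq nseq (node_mult m j) (node m j)
          | j <- index_iota (first_index cl) (nb_elements m).+1].

(* The element with end nodes z_j and z_(j+1). *)
Definition element m (j : nat) : set (plane R) :=
  gamma @` `[node_param m j, node_param m j.+1].

Definition elements m : set (set (plane R)) :=
  [set element m j | j in [set j | (j < nb_elements m)%N]].

Definition brackets m : set (set (plane R) * nat * nat) :=
  [set (element m j, node_mult m j, node_mult m j.+1)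
  | j in [set j | (j < nb_elements m)%N]].

Definition bracket_union (U : set (set (plane R) * nat * nat)) : set (plane R) :=
  \bigcup_(t in U) t.1.1.

(* The length of gamma^-1(T). *)
Definition param_length T : R :=
  fine (lebesgue_measure (`[start gamma, stop gamma] `&` gamma @^-1` T)).

(* At a node shared by two elements one of the two values is chosen; nodes are
   negligible for [arclength gamma]. *)
Definition mesh_width m (x : plane R) : R :=
  param_length (xget set0 [set T | elements m T /\ T x]).

(* The supremum of a finite nonempty set, hence a maximum. *)
Definition shape_ratio m : R :=
  sup [set param_length T.1 / param_length T.2
      | T in [set T | [/\ elements m T.1, elements m T.2 &
                          T.1 `&` T.2 !=set0]]].

Definition patch m U : set (plane R) :=
  \bigcup_(T in [set T | elements m T /\ T `&` U !=set0]) T.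

Definition bracket_patch m (U : set (set (plane R) * nat * nat)) :
    set (plane R) :=
  patch m (bracket_union U).

Definition refinement_strategy cl
    (ref : mesh gamma p -> set (plane R) -> mesh gamma p) : Prop :=
  forall m M, M `<=` nodes cl m ->
    M `<=` bracket_union (brackets m `\` brackets (ref m M)) /\
    subseq (knots cl m) (knots cl (ref m M)).

Inductive refinements cl (ref : mesh gamma p -> set (plane R) -> mesh gamma p)
    (m : mesh gamma p) : mesh gamma p -> Prop :=
| refinements_refl : refinements cl ref m m
| refinements_step m' M : refinements cl ref m m' -> M `<=` nodes cl m' ->
    refinements cl ref m (ref m' M).

End mesh_theory.

(* Main.v *)
Require Import Defs.
From HB Require Import structures.
From mathcomp Require Import all_boot all_order all_algebra.
From mathcomp Require Import zify lra.
From mathcomp Require Import all_classical all_reals all_analysis.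
From mathcomp Require Import ess_sup_inf measurable_realfun.

Set Implicit Arguments.
Unset Strict Implicit.
Unset Printing Implicit Defensive.
Import Order.TTheory GRing.Theory Num.Theory.
Import numFieldNormedType.Exports.

Local Open Scope classical_set_scope.
Local Open Scope ring_scope.

(** On an element T_j, the modified mesh size is the constant
      L_j * (A - N_j),
    where L_j is the parameter length of the patch of T_j (the union of the
    elements T_i meeting T_j), N_j is the sum of the multiplicities of the two
    end nodes of T_i over all these T_i, and A is a large constant depending on
    kappa_max and p only.  A patch has at most 5 elements, so
    0 <= N_j <= W := 10 (p + 1).  As ratios of adjacent elements are at most
    kappa_max, the value is equivalent to the length of T_j as soon as
    A >= W + 1.

    Let a mesh be refined, let T' be a fine element and T the coarse element
    containing it.  The fine patch of T' is a union of children of elements of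
    the coarse patch of T.  There are two cases.

    - All these children belong to the fine patch.  Then both patches have the
      same length, and the multiplicities can only grow, because a coarse node
      remains a node with at least its multiplicity
      ([sum_mult_children]).  If an element of the coarse patch has been
      changed, the sum grows by at least 1 ([patch_len_stable]).

    - Some child is missing.  The coarse patch is connected and its children
      are finitely many closed sets, so some missing child S meets an element of
      the fine patch ([coarse_patch_neighbour]).  By the bound kappa_max on the
      ratios of adjacent elements, S is at least 1 / D times as long as the fine
      patch, D := 5 kappa_max ^ 3, so the length of the patch is multiplied by
      at most D / (1 + D) ([patch_len_shrinks]).

    With A := (1 + D) (W + 1), the value is multiplied by at most 1 - 1 / A both
    in the second case and in the first one if the multiplicities grow
    ([mesh_value_refinement]).

    The identity of the two patches of changed elements holds because the
    coarse and the fine changed elements have the same union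
    ([bracket_union_coarse], [bracket_union_fine]).  Of the geometry of the
    path, only injectivity is used, for a closed path up to its end points.
    This makes the arcs of a mesh determine their
    parameter intervals, and the knots determine the nodes and their
    multiplicities. *)

(** * Bounded Borel functions and null sets *)

(** A bounded Borel function, given pointwise, has a class in L^oo; evaluating
    the class means evaluating some representative of it. *)
Lemma Linfty_of_bounded (R : realType) (gamma : pwC2_path R)
    (f : plane R -> measurableTypeR R) (M : R) :
  measurable_fun setT f ->
  (forall x, `|f x : R| <= M) ->
  exists g : Linfty gamma, {ae arclength gamma, forall x, g x = f x}.
Proof.
move=> mf fM.
pose mixf := isMeasurableFun.Build _ _ _ _ f mf.
pose F : {mfun plane R >-> measurableTypeR R} := HB.pack f mixf.
pose G : {mfun_(arclength gamma), plane R >-> measurableTypeR R} :=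
  \pi_{mfun_(arclength gamma), plane R >-> measurableTypeR R}%qT F.
have GF : {ae arclength gamma, forall x, G x = f x}.
  have /eqP := reprK G; rewrite {2}/G eqmodE => /asboolP.
  by apply: filterS => x /(_ I).
have fin : finite_norm (arclength gamma) +oo%E G.
  rewrite /finite_norm unlock; case: ifPn => // mu0.
  apply: (@le_lt_trans _ _ M%:E); last exact: ltry.
  apply/ess_supP; apply: filterS GF => x /= ->.
  by rewrite lee_fin.
pose mixG := isFinLebesgue.Build _ _ _ _ _ (leey 1) G fin.
pose H : Linfty gamma := HB.pack G mixG.
by exists H.
Qed.

Lemma arclength_countable (R : realType) (gamma : pwC2_path R)
    (N : set (plane R)) :
  countable (`[start gamma, stop gamma] `&` gamma @^-1` N) ->
  arclength gamma N = 0%E.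
Proof.
move=> cN; rewrite /arclength; apply: null_set_integral.
- apply: countable_measurable => //; exact: measurable_set1.
- apply/measurable_EFinP.
  have mI := @measurable_itv R `[start gamma, stop gamma].
  exact: measurable_funS mI (@subIsetl _ _ _) (@measurable_speed R gamma).
- exact: countable_lebesgue_measure0.
Qed.

(** The sigma-algebra of the plane is the product one; an open set is a
    countable union of squares with rational centres. *)
Lemma open_measurable_plane (R : realType) (U : set (plane R)) :
  open U -> measurable U.
Proof.
move=> oU.
pose B (q1 q2 : rat) (n : nat) : set (plane R) :=
  ball (ratr q1 : R) n.+1%:R^-1 `*` ball (ratr q2 : R) n.+1%:R^-1.
have -> : U = \bigcup_q1 \bigcup_q2 \bigcup_(n in [set n | B q1 q2 n `<=` U])
    B q1 q2 n.
  apply/seteqP; split => [x Ux|x [q1 _ [q2 _ [n nU]]]]; last exact: nU.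
  have /nbhs_ballP[e /= e0 eU] : nbhs x U by exact: open_nbhs_nbhs.
  have e20 : 0 < e / 2 by rewrite divr_gt0.
  have [n ne] : exists n : nat, n.+1%:R^-1 < e / 2.
    exists (Num.truncn (e / 2)^-1).
    by rewrite invf_plt ?posrE// truncnS_gt.
  have rat_near (y : R) : exists q : rat, `|ratr q - y| < n.+1%:R^-1.
    have [|q /itvP qy] := @rat_in_itvoo R (y - n.+1%:R^-1) (y + n.+1%:R^-1).
      by rewrite ltrD2l gtrN // ltr0n.
    by exists q; rewrite ltr_distl !qy.
  have [[q1 q1x] [q2 q2x]] := (rat_near x.1, rat_near x.2).
  exists q1 => //; exists q2 => //; exists n; last by split; rewrite /ball /=.
  have half (a b c d : R) : `|a - b| < d -> `|a - c| < d -> d < e / 2 ->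
      `|b - c| < e.
    by have := ler_distD a b c; rewrite (distrC b a); lra.
  move=> y [/= y1 y2]; apply: eU.
  by split; [apply: half q1x y1 ne|apply: half q2x y2 ne].
apply: bigcupT_measurable_rat => q1; apply: bigcupT_measurable_rat => q2.
apply: bigcup_measurable => n _; apply: measurableX; exact: measurable_ball.
Qed.

Lemma compact_measurable_plane (R : realType) (K : set (plane R)) :
  compact K -> measurable K.
Proof.
move=> cK; rewrite -(setCK K); apply: measurableC; apply: open_measurable_plane.
apply: closed_openC; apply: compact_closed cK.
exact: norm_hausdorff.
Qed.

(** * Parameters of the nodes *)

Section node_parameters.
Context (R : realType) (gamma : pwC2_path R) (p : nat).
Implicit Types m : mesh gamma p.

Lemma node_param0 m : node_param m 0 = start gamma.
Proof. by []. Qed.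

Lemma node_param_last m : node_param m (nb_elements m) = stop gamma.
Proof.
have [_ /eqP <-] := mesh_partition m.
by rewrite /node_param /nb_elements (last_nth (stop gamma)).
Qed.

Lemma node_param_lt m i j : (i <= nb_elements m)%N -> (j <= nb_elements m)%N ->
  (node_param m i < node_param m j) = (i < j)%N.
Proof.
have [sm _] := mesh_partition m.
have mono a b : (b <= nb_elements m)%N -> (a < b)%N ->
    node_param m a < node_param m b.
  move=> bn ab.
  apply: (@sorted_ltn_nth _ _ lt_trans _ (start gamma :: breaks m)) => //;
    rewrite inE /=; move: bn; rewrite /nb_elements; lia.
move=> i_n jn; case: (ltngtP i j) => [|ji|->]; last by rewrite ltxx.
- exact: mono.
- by rewrite lt_gtF// mono.
Qed.

Lemma node_param_le m i j : (i <= nb_elements m)%N -> (j <= nb_elements m)%N ->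
  (node_param m i <= node_param m j) = (i <= j)%N.
Proof. by move=> i_n jn; rewrite leNgt node_param_lt// (leqNgt i). Qed.

Lemma node_param_inj m i j : (i <= nb_elements m)%N -> (j <= nb_elements m)%N ->
  node_param m i = node_param m j -> i = j.
Proof.
move=> i_n jn zij; apply/eqP; rewrite eqn_leq.
by rewrite -(node_param_le i_n jn) -(node_param_le jn i_n) zij lexx.
Qed.

Lemma node_param_itv m i : (i <= nb_elements m)%N ->
  start gamma <= node_param m i <= stop gamma.
Proof.
by move=> i_n; rewrite -(node_param0 m) -(node_param_last m) !node_param_le.
Qed.

Lemma locate_param m a b t : (a < b)%N ->
  node_param m a <= t <= node_param m b ->
  exists2 k, (a <= k < b)%N & node_param m k <= t <= node_param m k.+1.
Proof.
elim: b => // b IH; rewrite ltnS => ab /andP[at_ tb].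
case: (lerP t (node_param m b)) => [tb'|/ltW bt]; last first.
  by exists b; rewrite ?ab ?leqnn ?bt ?tb.
move: ab; rewrite leq_eqVlt => /predU1P[abE|ab].
  by rewrite abE in at_ *; exists b; rewrite ?at_ ?leqnn.
have [|k /andP[ak kb] tk] := IH ab; first by rewrite at_ tb'.
by exists k; rewrite ?tk// ak ltnS ltnW.
Qed.

Lemma node_mult_gt0 m j : (j <= nb_elements m)%N -> (0 < node_mult m j)%N.
Proof.
move=> jn; have /(all_nthP 0%N)/(_ j) := mesh_mults m.
by rewrite mesh_size_mults ltnS jn => /(_ isT) /andP[].
Qed.

Lemma node_mult_le m j : (node_mult m j <= p.+1)%N.
Proof.
case: (ltnP j (size (mults m))) => jn; last by rewrite /node_mult nth_default.
by have /(all_nthP 0%N)/(_ j jn)/andP[] := mesh_mults m.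
Qed.

(** Length of the parameter interval of the element with index [j]. *)
Definition elt_len m j : R := node_param m j.+1 - node_param m j.

Lemma elt_len_gt0 m j : (j < nb_elements m)%N -> 0 < elt_len m j.
Proof. by move=> jn; rewrite subr_gt0 node_param_lt// ltnW. Qed.

(** Sum of the multiplicities of the two end nodes of an element. *)
Definition elt_mult m j : nat := node_mult m j + node_mult m j.+1.

Lemma elt_mult_le m j : (elt_mult m j <= 2 * p.+1)%N.
Proof. by rewrite mul2n -addnn leq_add// node_mult_le. Qed.

End node_parameters.

(** * Elements as arcs of a simple path *)

Section simple_paths.
Context (R : realType) (gamma : pwC2_path R).

(** The path has no self-intersection, except that its end points may
    coincide; this covers open and closed boundaries at once. *)
Definition simple_path : Prop := forall s t,
  start gamma <= s <= stop gamma -> start gamma <= t <= stop gamma ->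
  gamma s = gamma t ->
  [\/ s = t, s = start gamma /\ t = stop gamma |
      s = stop gamma /\ t = start gamma].

Lemma closed_path_ends cl Omega Gamma : boundary_setting cl Omega Gamma gamma ->
  cl -> gamma (stop gamma) = gamma (start gamma).
Proof.
move=> bs /(setting_closed bs)[_ per _].
by rewrite -[in RHS]per addrC subrK.
Qed.

Lemma boundary_simple_path cl Omega Gamma :
  boundary_setting cl Omega Gamma gamma -> simple_path.
Proof.
move=> bs s t /andP[s0 s1] /andP[t0 t1] st.
have ab := start_lt_stop gamma.
case: cl bs => bs; last first.
  have [_ [_ inj _]] := setting_open bs isT.
  by apply: Or31; apply: inj => //; rewrite inE /= in_itv /= ?s0 ?t0.
have ends := closed_path_ends bs isT.
have [_ _ [_ inj _]] := setting_closed bs isT.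
have inj' u v : start gamma <= u < stop gamma -> start gamma <= v < stop gamma ->
    gamma u = gamma v -> u = v.
  by move=> hu hv; apply: inj; rewrite inE /= in_itv.
move: s1 t1; rewrite !le_eqVlt => /predU1P[s1|s1] /predU1P[t1|t1].
- by apply: Or31; rewrite s1 t1.
- apply: Or33; split => //; apply: inj'; rewrite ?t0 ?t1 ?lexx ?ab//.
  by rewrite -st s1 ends.
- apply: Or32; split => //; apply: inj'; rewrite ?s0 ?s1 ?lexx ?ab//.
  by rewrite st t1 ends.
- by apply: Or31; apply: inj'; rewrite ?s0 ?t0.
Qed.

Lemma open_path_inj cl Omega Gamma s t : boundary_setting cl Omega Gamma gamma ->
  ~~ cl -> start gamma <= s <= stop gamma -> start gamma <= t <= stop gamma ->
  gamma s = gamma t -> s = t.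
Proof.
move=> bs ncl hs ht; have [_ [_ inj _]] := setting_open bs ncl.
by apply: inj; rewrite inE /= in_itv.
Qed.

End simple_paths.

Section element_geometry.
Context (R : realType) (gamma : pwC2_path R) (p : nat).
Implicit Types m : mesh gamma p.
Context (sg : simple_path gamma).

Lemma elementP m j x : element m j x <->
  exists2 t, node_param m j <= t <= node_param m j.+1 & gamma t = x.
Proof.
split=> [[t]|[t ht <-]]; first by rewrite /= in_itv /=; exists t.
by exists t => //=; rewrite in_itv.
Qed.

Lemma element_param_itv m j t : (j < nb_elements m)%N ->
  node_param m j <= t <= node_param m j.+1 -> start gamma <= t <= stop gamma.
Proof.
move=> jn /andP[jt tj]; have /andP[h1 _] := node_param_itv (ltnW jn).
have /andP[_ h2] := node_param_itv jn.
by rewrite (le_trans h1 jt) (le_trans tj h2).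
Qed.

Lemma mem_element_interior m j t : (j < nb_elements m)%N ->
  start gamma < t < stop gamma -> element m j (gamma t) ->
  node_param m j <= t <= node_param m j.+1.
Proof.
move=> jn /andP[t0 t1] /elementP[s hs st].
have hs' := element_param_itv jn hs.
have [|<-//|[_ tE]|[_ tE]] := sg hs' _ st.
- by rewrite !ltW.
- by rewrite tE ltxx in t1.
- by rewrite tE ltxx in t0.
Qed.

(** An element determines its parameter interval: each parameter in the
    interior of the interval has a point with no other preimage. *)
Lemma element_subP m m' i k : (i < nb_elements m)%N -> (k < nb_elements m')%N ->
  element m' k `<=` element m i <->
  node_param m i <= node_param m' k /\ node_param m' k.+1 <= node_param m i.+1.
Proof.
move=> i_n kn; split=> [sub|[h1 h2] x /elementP[t /andP[t1 t2] <-]]; last first.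
  by apply/elementP; exists t => //; rewrite (le_trans h1 t1) (le_trans t2 h2).
have zk : node_param m' k < node_param m' k.+1 by rewrite node_param_lt// ltnW.
have mid t : node_param m' k < t < node_param m' k.+1 ->
    node_param m i <= t <= node_param m i.+1.
  move=> /andP[t1 t2]; apply: mem_element_interior => //.
    have /andP[h1 _] := node_param_itv (ltnW kn).
    have /andP[_ h2] := node_param_itv kn.
    by rewrite (le_lt_trans h1 t1) (lt_le_trans t2 h2).
  by apply: sub; apply/elementP; exists t => //; rewrite !ltW.
split; rewrite leNgt; apply/negP => h.
- have [t [t1 t2 t3]] : exists t, [/\ node_param m' k < t,
      t < node_param m' k.+1 & t < node_param m i].
    case: (ltP (node_param m i) (node_param m' k.+1)) => ?.
      by exists ((node_param m' k + node_param m i) / 2); split; lra.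
    by exists ((node_param m' k + node_param m' k.+1) / 2); split; lra.
  by have := mid t; rewrite t1 t2 => /(_ isT)/andP[]; rewrite leNgt t3.
- have [t [t1 t2 t3]] : exists t, [/\ node_param m' k < t,
      t < node_param m' k.+1 & node_param m i.+1 < t].
    case: (ltP (node_param m' k) (node_param m i.+1)) => ?.
      by exists ((node_param m i.+1 + node_param m' k.+1) / 2); split; lra.
    by exists ((node_param m' k + node_param m' k.+1) / 2); split; lra.
  by have := mid t; rewrite t1 t2 => /(_ isT)/andP[_]; rewrite leNgt t3.
Qed.

Lemma element_inj m m' i k : (i < nb_elements m)%N -> (k < nb_elements m')%N ->
  element m i = element m' k ->
  node_param m i = node_param m' k /\ node_param m i.+1 = node_param m' k.+1.
Proof.
move=> i_n kn E.
have /(element_subP i_n kn)[h1 h2] : element m' k `<=` element m i by rewrite E.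
have /(element_subP kn i_n)[h3 h4] : element m i `<=` element m' k by rewrite E.
by split; apply/eqP; rewrite eq_le ?h1 ?h2 ?h3 ?h4.
Qed.

Lemma element_nonempty m j : (j < nb_elements m)%N -> element m j !=set0.
Proof.
move=> jn; exists (gamma (node_param m j)); apply/elementP.
by exists (node_param m j) => //; rewrite lexx node_param_le// ltnW.
Qed.

Lemma element_continuous m j : (j < nb_elements m)%N ->
  {within `[node_param m j, node_param m j.+1], continuous gamma}.
Proof.
move=> jn; apply: continuous_subspaceW (@path_continuous _ gamma) => t /=.
by rewrite !in_itv /=; exact: element_param_itv.
Qed.

Lemma element_compact m j : (j < nb_elements m)%N -> compact (element m j).
Proof.
move=> jn; apply: continuous_compact; first exact: element_continuous.
exact: segment_compact.
Qed.

Lemma element_connected m j : (j < nb_elements m)%N -> connected (element m j).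
Proof.
move=> jn; apply: connected_continuous_connected; last exact: element_continuous.
exact: segment_connected.
Qed.

Lemma param_length_element m j : (j < nb_elements m)%N ->
  param_length gamma (element m j) = elt_len m j.
Proof.
move=> jn; rewrite /param_length.
set P := (X in lebesgue_measure X).
pose I : set R := `[node_param m j, node_param m j.+1]%classic.
have IP : I `<=` P.
  move=> t It; split; last by exists t.
  by move: It; rewrite /I /= !in_itv /=; exact: element_param_itv.
(* an end point of the path may be an additional preimage *)
have PI : P `\` I `<=` [set start gamma; stop gamma].
  move=> t [[/= ht tj] tI].
  move: ht; rewrite in_itv /= => /andP[]; rewrite !le_eqVlt.
  move=> /predU1P[<-|t0]; first by left.
  move=> /predU1P[->|t1]; first by right.
  case: tI; rewrite /I /= in_itv /=.
  by apply: mem_element_interior => //; rewrite t0.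
have cPI : countable (P `\` I).
  apply: (@finite_set_countable R); apply: sub_finite_set PI _.
  exact: finite_set2.
rewrite -(setDUK IP).
rewrite measureU0 /=.
- rewrite lebesgue_measure_itv /= lte_fin.
  by rewrite node_param_lt ?leqnn ?ltnSn// ltnW.
- exact: measurable_itv.
- apply: countable_measurable => //; exact: measurable_set1.
- exact: countable_lebesgue_measure0.
Qed.

End element_geometry.

(** * Nested meshes *)

Section nested_meshes.
Context (R : realType) (gamma : pwC2_path R) (p : nat).
Implicit Types m : mesh gamma p.

(** Each node of [m] is a node of [m'], with at least the same multiplicity. *)
Definition nested m m' : Prop := forall j, (j <= nb_elements m)%N ->
  exists k, [/\ (k <= nb_elements m')%N, node_param m' k = node_param m j &
                (node_mult m j <= node_mult m' k)%N].

Lemma count_knots cl m x : count_mem x (knots cl m) =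
  (\sum_(first_index cl <= j < (nb_elements m).+1 | node m j == x)
    node_mult m j)%N.
Proof.
rewrite /knots count_flatten sumnE !big_map [RHS]big_mkcond /=.
apply: eq_bigr => j _; rewrite count_nseq /= eq_sym.
by case: eqP => _; rewrite ?mul1n ?mul0n.
Qed.

(** The nodes listed in the knots determine their parameters: for a closed
    path, [start gamma] is not among these parameters. *)
Lemma node_inj cl Omega Gamma m m' i k :
  boundary_setting cl Omega Gamma gamma ->
  (first_index cl <= i <= nb_elements m)%N ->
  (first_index cl <= k <= nb_elements m')%N ->
  node m i = node m' k -> node_param m i = node_param m' k.
Proof.
move=> bs /andP[i1 i2] /andP[k1 k2] ik.
have hi := node_param_itv i2; have hk := node_param_itv k2.
case: (boolP cl) => ccl; last exact: open_path_inj bs ccl hi hk ik.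
move: i1 k1; rewrite ccl /= => i1 k1.
have pos m1 j : (0 < j)%N -> (j <= nb_elements m1)%N ->
    node_param m1 j <> start gamma.
  by move=> j0 jn E; have := node_param_lt (leq0n _) jn; rewrite E ltxx j0.
have [//|[E _]|[_ E]] := boundary_simple_path bs hi hk ik.
- by case: (pos _ _ i1 i2).
- by case: (pos _ _ k1 k2).
Qed.

Lemma count_knots_node cl Omega Gamma m j :
  boundary_setting cl Omega Gamma gamma ->
  (first_index cl <= j <= nb_elements m)%N ->
  count_mem (node m j) (knots cl m) = node_mult m j.
Proof.
move=> bs hj; rewrite count_knots big_mkcond /= (bigD1_seq j) //=; last 2 first.
- by rewrite mem_index_iota ltnS.
- exact: iota_uniq.
rewrite eqxx big_seq_cond big1 ?addn0// => i /andP[].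
rewrite mem_index_iota ltnS => hi ij; case: eqP => // E.
move: (hi) (hj) => /andP[_ i2] /andP[_ j2].
by rewrite (node_param_inj i2 j2 (node_inj bs hi hj E)) eqxx in ij.
Qed.

(** The multiplicity of a node is its number of occurrences in the knots, which
    cannot be smaller in a sequence that has the knots as a subsequence. *)
Lemma knots_nested cl Omega Gamma m m' : boundary_setting cl Omega Gamma gamma ->
  subseq (knots cl m) (knots cl m') -> nested m m'.
Proof.
move=> bs sub j jn.
case: (leqP (first_index cl) j) => [j1|]; last first.
  (* only z_0 of a closed path is not listed among the knots *)
  case: (cl) => //=; rewrite ltnS leqn0 => /eqP ->; exists 0%N; split => //.
  by rewrite /node_mult !mesh_mult_first.
have hj : (first_index cl <= j <= nb_elements m)%N by rewrite j1.
have /= le_count := leq_count_subseq (pred1 (node m j)) sub.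
rewrite (count_knots_node bs hj) in le_count.
have /hasP[k hk /eqP E] : has (fun k => node m' k == node m j)
    (index_iota (first_index cl) (nb_elements m').+1).
  rewrite -[has _ _]negbK -all_predC; apply/negP => /allP no.
  have := leq_trans (node_mult_gt0 jn) le_count.
  by rewrite count_knots big_seq_cond big1// => k /andP[/no/negP].
rewrite mem_index_iota ltnS in hk.
exists k; split; first by case/andP: hk.
- exact: node_inj bs hk hj E.
- by rewrite -E (count_knots_node bs hk) in le_count.
Qed.

Lemma nested_refl m : nested m m.
Proof. by move=> j jn; exists j. Qed.

Lemma nested_trans m1 m2 m3 : nested m1 m2 -> nested m2 m3 -> nested m1 m3.
Proof.
move=> n12 n23 j /n12[k [/n23[l [l3 lk kl]] kj jk]].
by exists l; split => //; [rewrite lk|exact: leq_trans jk kl].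
Qed.

Lemma refinements_nested cl Omega Gamma ref m m' :
  boundary_setting cl Omega Gamma gamma -> refinement_strategy cl ref ->
  refinements cl ref m m' -> nested m m'.
Proof.
move=> bs rs; elim=> [|m1 M _ IH Mn]; first exact: nested_refl.
by apply: nested_trans IH _; apply: knots_nested bs _; case: (rs _ _ Mn).
Qed.

Lemma refinements_trans cl ref m1 m2 m3 : refinements cl ref m1 m2 ->
  refinements (gamma := gamma) (p := p) cl ref m2 m3 -> refinements cl ref m1 m3.
Proof. by move=> r12; elim=> // m M _ IH Mn; exact: refinements_step. Qed.

(** Index in [m'] of the node of [m] with index [j]. *)
Definition embed m m' (j : nat) : nat :=
  index (node_param m j) (start gamma :: breaks m').

Section embedding.
Context (m m' : mesh gamma p) (nest : nested m m').
Local Notation f := (embed m m').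

Lemma embedP j : (j <= nb_elements m)%N ->
  [/\ (f j <= nb_elements m')%N, node_param m' (f j) = node_param m j &
      (node_mult m j <= node_mult m' (f j))%N].
Proof.
move=> jn; have [k [kn E le_mult]] := nest jn.
suff -> : f j = k by [].
have in_breaks : node_param m j \in start gamma :: breaks m'.
  by rewrite -E mem_nth// ltnS.
apply: (@node_param_inj _ _ _ m') => //.
  by move: in_breaks; rewrite -index_mem.
by rewrite E /node_param /embed nth_index.
Qed.

Lemma embed_lt i j : (i <= nb_elements m)%N -> (j <= nb_elements m)%N ->
  (f i < f j)%N = (i < j)%N.
Proof.
move=> i_n jn; have [h1 h2 _] := embedP i_n; have [h3 h4 _] := embedP jn.
by rewrite -(node_param_lt h1 h3) h2 h4 node_param_lt.
Qed.

Lemma embed_le i j : (i <= nb_elements m)%N -> (j <= nb_elements m)%N ->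
  (f i <= f j)%N = (i <= j)%N.
Proof. by move=> i_n jn; rewrite leqNgt embed_lt// -leqNgt. Qed.

Lemma embed0 : f 0 = 0%N.
Proof. by rewrite /embed node_param0 /= eqxx. Qed.

Lemma embed_last : f (nb_elements m) = nb_elements m'.
Proof.
have [h1 h2 _] := embedP (leqnn _).
by apply: (node_param_inj h1) => //; rewrite h2 !node_param_last.
Qed.

(** The element of [m'] with index [k] lies in the element of [m] with
    index [i]; in terms of indices, it is one of those between the two end
    nodes of the latter. *)
Definition child (i k : nat) : bool := (f i <= k < f i.+1)%N.

Lemma child_lt i k : (i < nb_elements m)%N -> child i k -> (k < nb_elements m')%N.
Proof.
move=> i_n /andP[_ kf]; have [h _ _] := embedP i_n.
exact: leq_trans kf h.
Qed.

Lemma child_exists k : (k < nb_elements m')%N ->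
  exists2 i, (i < nb_elements m)%N & child i k.
Proof.
rewrite -embed_last; elim: (nb_elements m) => [|n IH]; first by rewrite embed0.
case: (ltnP k (f n)) => [/IH[i i_n ik] _|nk kn]; last first.
  by exists n; rewrite /child ?nk.
by exists i => //; exact: ltnW.
Qed.

Lemma child_inj i j k : (i < nb_elements m)%N -> (j < nb_elements m)%N ->
  child i k -> child j k -> i = j.
Proof.
move=> i_n jn /andP[i1 i2] /andP[j1 j2].
have := leq_ltn_trans i1 j2; have := leq_ltn_trans j1 i2.
rewrite !embed_lt ?ltnS//; [lia|exact: ltnW|exact: ltnW].
Qed.

Lemma child_itv i k : (i < nb_elements m)%N -> child i k ->
  node_param m i <= node_param m' k /\ node_param m' k.+1 <= node_param m i.+1.
Proof.
move=> i_n ik; have kn := child_lt i_n ik; case/andP: ik => ik ki.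
have [h1 <- _] := embedP (ltnW i_n); have [h2 <- _] := embedP i_n.
by rewrite !node_param_le// ltnW.
Qed.

Lemma child_sub i k : (i < nb_elements m)%N -> child i k ->
  element m' k `<=` element m i.
Proof.
move=> i_n ik x /elementP[t /andP[t1 t2] <-]; have [h1 h2] := child_itv i_n ik.
by apply/elementP; exists t => //; rewrite (le_trans h1 t1) (le_trans t2 h2).
Qed.

Lemma element_children i x : (i < nb_elements m)%N -> element m i x ->
  exists2 k, child i k & element m' k x.
Proof.
move=> i_n /elementP[t ht <-].
have [_ h1 _] := embedP (ltnW i_n); have [_ h2 _] := embedP i_n.
have [||k ik tk] := @locate_param _ _ _ m' (f i) (f i.+1) t.
- by rewrite embed_lt// ltnW.
- by rewrite h1 h2.
- by exists k => //; apply/elementP; exists t.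
Qed.

(** The element of [m] with index [i] is an element of [m'] with the same
    multiplicities. *)
Definition kept (i : nat) : bool :=
  [&& f i.+1 == (f i).+1, node_mult m' (f i) == node_mult m i &
      node_mult m' (f i.+1) == node_mult m i.+1].

Lemma kept_child i k : kept i -> child i k -> k = f i.
Proof. by move=> /and3P[/eqP E _ _]; rewrite /child E; lia. Qed.

(** A sum over fine elements is grouped by the coarse elements containing them,
    for a selection [Q] that depends on the coarse element only. *)
Lemma sum_children (g : nat -> R) (P : pred nat) (Q : pred nat) :
  (forall i k, (i < nb_elements m)%N -> child i k -> Q k = P i) ->
  \sum_(0 <= k < nb_elements m' | Q k) g k =
  \sum_(0 <= i < nb_elements m | P i) \sum_(f i <= k < f i.+1) g k.
Proof.
rewrite -embed_last => QP.
suff {QP} H n : (n <= nb_elements m)%N ->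
    (forall i k, (i < n)%N -> child i k -> Q k = P i) ->
  \sum_(0 <= k < f n | Q k) g k =
  \sum_(0 <= i < n | P i) \sum_(f i <= k < f i.+1) g k by exact: H.
elim: n => [|n IH] nm QP; first by rewrite embed0 !big_geq.
have le_f : (f n <= f n.+1)%N by rewrite embed_le// ltnW.
rewrite (big_cat_nat (leq0n _) le_f) /= IH //; first last.
- by move=> i k i_n; apply: QP; exact: ltnW.
- exact: ltnW.
rewrite [RHS]big_mkcond big_nat_recr//= -big_mkcond; congr (_ + _).
rewrite big_nat_cond; case: ifP => Pn.
- rewrite [RHS]big_nat_cond; apply: eq_bigl => k; rewrite andbT.
  by case: (boolP (_ <= k < _)%N) => //= hk; rewrite (QP n k).
- by apply: big1 => // k /andP[hk]; rewrite (QP n k)// Pn.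
Qed.

Lemma sum_len_children i : (i < nb_elements m)%N ->
  \sum_(f i <= k < f i.+1) elt_len m' k = elt_len m i.
Proof.
move=> i_n; rewrite telescope_sumr ?embed_le// ?(ltnW i_n)//.
by have [_ -> _] := embedP (ltnW i_n); have [_ -> _] := embedP i_n.
Qed.

(** A split element has an inner node in addition to its end nodes. *)
Lemma sum_mult_children i : (i < nb_elements m)%N ->
  (elt_mult m i + ~~ kept i <= \sum_(f i <= k < f i.+1) elt_mult m' k)%N.
Proof.
move=> i_n; have := embed_lt (ltnW i_n) i_n; rewrite ltnSn.
have [_ _ m1] := embedP (ltnW i_n); have [h2 _ m2] := embedP i_n.
rewrite leq_eqVlt => /predU1P[E|].
- rewrite -E big_nat1 /elt_mult E /kept -E eqxx /=.
  rewrite -E in m2; case: (node_mult m' (f i) =P node_mult m i) => ? /=;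
    case: (node_mult m' (f i).+1 =P node_mult m i.+1) => ? /=; lia.
- move=> lt2; rewrite big_ltn 1?ltnW//.
  have -> : f i.+1 = (f i.+1).-1.+1 by lia.
  rewrite big_nat_recr /=; last lia.
  have := @node_mult_gt0 _ _ _ m' (f i).+1.
  have := @node_mult_gt0 _ _ _ m' (f i.+1).-1.
  rewrite /elt_mult; have -> : (f i.+1).-1.+1 = f i.+1 by lia.
  by have := leq_b1 (~~ kept i); lia.
Qed.

End embedding.
End nested_meshes.

(** * Changed elements and their patches *)

Section changed_elements.
Context (R : realType) (gamma : pwC2_path R) (p : nat).
Context (sg : simple_path gamma).
Context (m m' : mesh gamma p) (nest : nested m m').
Local Notation f := (embed m m').
Local Notation child := (child m m').
Local Notation kept := (kept m m').

(** The union of the elements of the coarse mesh that are not kept. *)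
Definition changed : set (plane R) :=
  \bigcup_(i in [set i | (i < nb_elements m)%N && ~~ kept i]) element m i.

(** The element with index [i], together with the multiplicities of its ends. *)
Definition bracket (mm : mesh gamma p) i :=
  (element mm i, node_mult mm i, node_mult mm i.+1).

Lemma bracketP (m1 m2 : mesh gamma p) i :
  (i < nb_elements m1)%N -> brackets m2 (bracket m1 i) <->
  exists k, [/\ (k < nb_elements m2)%N,
    node_param m2 k = node_param m1 i /\ node_param m2 k.+1 = node_param m1 i.+1,
    node_mult m2 k = node_mult m1 i & node_mult m2 k.+1 = node_mult m1 i.+1].
Proof.
move=> i_n; split=> [[k kn [E M1 M2]]|[k [kn [E1 E2] M1 M2]]]; exists k => //.
  by split => //; exact: (element_inj sg kn i_n E).
by rewrite /bracket /element E1 E2 M1 M2.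
Qed.

Lemma kept_bracket i : (i < nb_elements m)%N ->
  brackets m' (bracket m i) <-> kept i.
Proof.
move=> i_n; have [h1 h2 _] := embedP nest (ltnW i_n).
have [h3 h4 _] := embedP nest i_n.
rewrite bracketP//.
split=> [[k [kn [E1 E2] M1 M2]]|/and3P[/eqP E /eqP M1 /eqP M2]].
- have kE : k = f i by apply: (node_param_inj (ltnW kn)); rewrite ?h2.
  have k1E : k.+1 = f i.+1 by apply: (node_param_inj kn); rewrite ?h4.
  by rewrite /kept -k1E -kE M1 M2 !eqxx.
- by exists (f i); rewrite -E h2 h4 M1 M2; split=> //; rewrite -E in h3 *.
Qed.

Lemma child_bracket i k : (i < nb_elements m)%N -> child i k ->
  brackets m (bracket m' k) <-> kept i.
Proof.
move=> i_n ik; have kn := child_lt nest i_n ik.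
have [h1 h2 _] := embedP nest (ltnW i_n); have [h3 h4 _] := embedP nest i_n.
have [c1 c2] := child_itv nest i_n ik.
rewrite bracketP//; split=> [[j [jn [E1 E2] M1 M2]]|ki].
- have jE : j = i.
    rewrite -E1 in c1; rewrite -E2 in c2.
    by move: c1 c2; rewrite !node_param_le// ?ltnS ?(ltnW i_n) ?(ltnW jn)//; lia.
  rewrite jE in E1 E2 M1 M2.
  have kE : k = f i by apply: (node_param_inj (ltnW kn)); rewrite ?h2.
  have k1E : k.+1 = f i.+1 by apply: (node_param_inj kn); rewrite ?h4.
  by rewrite /kept -k1E -kE M1 M2 !eqxx.
- have kE := kept_child ki ik.
  move: ki => /and3P[/eqP E /eqP M1 /eqP M2].
  by exists i; rewrite kE -E h2 h4 M1 M2.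
Qed.

Lemma bracket_union_coarse :
  bracket_union (brackets m `\` brackets m') = changed.
Proof.
apply/seteqP; split=> [x [_ [[i i_n <-] nB] /= xi]|x [i /andP[i_n ki] xi]].
- exists i => //=; rewrite [(i < _)%N]i_n /=; apply/negP => ki; apply: nB.
  exact/kept_bracket.
- exists (bracket m i) => //; split; first by exists i.
  by move/(kept_bracket i_n); exact/negP.
Qed.

Lemma bracket_union_fine :
  bracket_union (brackets m' `\` brackets m) = changed.
Proof.
apply/seteqP; split=> [x [_ [[k kn <-] nB] /= xk]|x [i /andP[i_n ki] xi]].
- have [i i_n ik] := child_exists nest kn.
  exists i; last exact: (child_sub nest i_n ik).
  rewrite /= i_n /=; apply/negP => ki; apply: nB.
  exact/(child_bracket i_n ik).
- have [k ik xk] := element_children nest i_n xi.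
  exists (bracket m' k) => //; split.
    by exists k => //; exact: (child_lt nest i_n ik).
  by move/(child_bracket i_n ik); exact/negP.
Qed.

Lemma changed_children i k : (i < nb_elements m)%N -> child i k -> ~~ kept i ->
  element m' k `<=` changed.
Proof.
move=> i_n ik ki x /(child_sub nest i_n ik) xi.
by exists i => //=; rewrite i_n.
Qed.

(** An element meeting the changed part is either changed, hence contained in
    it, or common to both meshes. *)
Lemma patch_changed :
  bracket_patch m' (brackets m' `\` brackets m) =
  bracket_patch m (brackets m `\` brackets m').
Proof.
rewrite /bracket_patch bracket_union_coarse bracket_union_fine.
apply/seteqP; split=> x [_ [[k kn <-] [y [yk yC]]] xk].
- have [i i_n ik] := child_exists nest kn.
  have sub := child_sub nest i_n ik.
  exists (element m i); last exact: sub.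
  by split; [exists i|exists y; split => //; exact: sub].
- have [l kl xl] := element_children nest kn xk.
  have ln := child_lt nest kn kl.
  exists (element m' l) => //; split; first by exists l.
  case: (boolP (kept k)) => kk.
  + have lE := kept_child kk kl; have [l' kl' yl'] := element_children nest kn yk.
    by exists y; split => //; rewrite lE -(kept_child kk kl').
  + by exists x; split => //; exact: (changed_children kn kl).
Qed.

End changed_elements.

(** * Adjacent elements *)

Section adjacency.
Context (R : realType) (gamma : pwC2_path R) (p : nat).
Context (sg : simple_path gamma).
Implicit Types m : mesh gamma p.

(** The elements with indices [i] and [j] meet. *)
Definition adj m i j : bool := `[< element m i `&` element m j !=set0 >].

Lemma adjP m i j : reflect (element m i `&` element m j !=set0) (adj m i j).
Proof. exact: asboolP. Qed.

Lemma adj_refl m i : (i < nb_elements m)%N -> adj m i i.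
Proof. by move=> i_n; apply/adjP; rewrite setIid; exact: element_nonempty. Qed.

Lemma adj_sym m i j : adj m i j = adj m j i.
Proof. by rewrite /adj setIC. Qed.

(** The last two indices account for the first and the last element, which
    meet if the path is closed. *)
Lemma adj_indices m i j : (i < nb_elements m)%N -> (j < nb_elements m)%N ->
  adj m i j -> i \in [:: j.-1; j; j.+1; 0%N; (nb_elements m).-1].
Proof.
move=> i_n jn /adjP[x [/elementP[s hs <-] /elementP[t ht st]]].
have hs' := element_param_itv i_n hs; have ht' := element_param_itv jn ht.
case/andP: hs => s1 s2; case/andP: ht => t1 t2.
rewrite !inE; have [E|[_ E]|[_ E]] := sg ht' hs' st.
- have h1 := le_trans s1 (eq_ind t (fun t => t <= _) t2 _ E).
  have h2 := le_trans t1 (eq_ind_r (fun t => t <= _) s2 E).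
  by move: h1 h2; rewrite !node_param_le ?(ltnW i_n) ?(ltnW jn)//; lia.
- by move: s2; rewrite E -(node_param_last m) node_param_le//; lia.
- by move: s1; rewrite E -(node_param0 m) node_param_le ?(ltnW i_n)//; lia.
Qed.

Lemma sum_adj_le m j (g : nat -> R) c : (j < nb_elements m)%N -> 0 <= c ->
  (forall i, (i < nb_elements m)%N -> adj m i j -> g i <= c) ->
  \sum_(0 <= i < nb_elements m | adj m i j) g i <= 5 * c.
Proof.
move=> jn c0 gc; rewrite -big_filter.
set s := [seq _ <- _ | _].
have sP i : i \in s -> (i < nb_elements m)%N /\ adj m i j.
  by rewrite mem_filter mem_index_iota => /andP[-> /andP[_ ->]].
apply: (@le_trans _ _ (\sum_(i <- s) c)).
  by rewrite !big_seq; apply: ler_sum => i /sP[]; exact: gc.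
rewrite big_const_seq iter_addr_0 count_predT -[leLHS]mulr_natl ler_wpM2r//.
rewrite ler_nat.
apply: (@uniq_leq_size _ s [:: j.-1; j; j.+1; 0%N; (nb_elements m).-1]).
  by rewrite filter_uniq// iota_uniq.
by move=> i /sP[i_n ij]; exact: adj_indices.
Qed.

Lemma shape_ratio_adj m kappa i j : shape_ratio m <= kappa ->
  (i < nb_elements m)%N -> (j < nb_elements m)%N -> adj m i j ->
  elt_len m i <= kappa * elt_len m j.
Proof.
move=> hk i_n jn /adjP ij.
rewrite -ler_pdivrMr ?elt_len_gt0//; apply: le_trans hk.
rewrite -!(param_length_element sg)//.
apply: ub_le_sup; last first.
  exists (element m i, element m j) => //=.
  by split=> //; [exists i|exists j].
(* the supremum defining the shape ratio is that of a bounded set: the sum of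
   all ratios is an upper bound *)
exists (\sum_(0 <= a < nb_elements m) \sum_(0 <= b < nb_elements m)
  elt_len m a / elt_len m b) => _ [[T1 T2] /= [[a an <-] [b bn <-] _] <-].
rewrite !(param_length_element sg)//.
have pos c d : (c < nb_elements m)%N -> (d < nb_elements m)%N ->
    0 <= elt_len m c / elt_len m d.
  by move=> cn dn; rewrite divr_ge0// ltW// elt_len_gt0.
rewrite (bigD1_seq a) ?mem_index_iota ?iota_uniq//=.
rewrite (bigD1_seq b) ?mem_index_iota ?iota_uniq//=.
rewrite -addrA lerDl addr_ge0//.
- rewrite big_seq_cond sumr_ge0// => c; rewrite mem_index_iota => /andP[cn _].
  exact: pos.
- rewrite big_seq_cond sumr_ge0// => c; rewrite mem_index_iota => /andP[cn _].
  rewrite big_seq_cond sumr_ge0// => d; rewrite mem_index_iota => /andP[dn _].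
  exact: pos.
Qed.

(** Length of the parameter set of the patch of the element with index [j]. *)
Definition patch_len m j : R :=
  \sum_(0 <= i < nb_elements m | adj m i j) elt_len m i.

(** Multiplicities in the patch; a node is counted once for each element of
    the patch of which it is an end. *)
Definition patch_mult m j : R :=
  \sum_(0 <= i < nb_elements m | adj m i j) (elt_mult m i)%:R.

Lemma patch_mult_ge0 m j : 0 <= patch_mult m j.
Proof. exact: sumr_ge0. Qed.

Lemma patch_mult_le m j : (j < nb_elements m)%N ->
  patch_mult m j <= 10 * p.+1%:R.
Proof.
move=> jn; have := @sum_adj_le m j (fun i => (elt_mult m i)%:R) (2 * p.+1%:R) jn.
rewrite mulrA -!natrM => H; apply: H => // i _ _.
by rewrite -?natrM ler_nat elt_mult_le.
Qed.

Lemma patch_len_ge m j : (j < nb_elements m)%N -> elt_len m j <= patch_len m j.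
Proof.
move=> jn; rewrite /patch_len big_mkcond.
rewrite (bigD1_seq j) ?mem_index_iota ?iota_uniq//=.
rewrite adj_refl// lerDl big_seq_cond sumr_ge0// => i.
rewrite mem_index_iota => /andP[i_n _]; case: ifP => // _.
by rewrite ltW// elt_len_gt0.
Qed.

Lemma patch_len_gt0 m j : (j < nb_elements m)%N -> 0 < patch_len m j.
Proof. by move=> jn; exact: lt_le_trans (elt_len_gt0 jn) (patch_len_ge jn). Qed.

Lemma patch_len_le m kappa j : shape_ratio m <= kappa -> 0 <= kappa ->
  (j < nb_elements m)%N -> patch_len m j <= 5 * (kappa * elt_len m j).
Proof.
move=> hk k0 jn; apply: sum_adj_le => //.
  by rewrite mulr_ge0// ltW// elt_len_gt0.
by move=> i i_n; exact: shape_ratio_adj.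
Qed.

End adjacency.

(** * Patches under refinement *)

Section patch_refinement.
Context (R : realType) (gamma : pwC2_path R) (p : nat).
Context (sg : simple_path gamma).
Context (m m' : mesh gamma p) (nest : nested m m').
Context (kappa : R) (kappa_ge1 : 1 <= kappa).
Context (shape' : shape_ratio m' <= kappa).
Local Notation child := (child m m').
Local Notation kept := (kept m m').

(** The element of [m'] with index [l] lies in the patch of the element of
    [m] with index [j]. *)
Definition in_coarse_patch j l : bool :=
  `[< exists i, [/\ (i < nb_elements m)%N, child i l & adj m i j] >].

Lemma in_coarse_patch_child i j l : (i < nb_elements m)%N -> child i l ->
  in_coarse_patch j l = adj m i j.
Proof.
move=> i_n il; apply/asboolP/idP => [[i' [i'n i'l]]|ij]; last by exists i.
by rewrite (child_inj nest i'n i_n i'l il).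
Qed.

Lemma adj_in_coarse_patch j k l : (j < nb_elements m)%N -> child j k ->
  (l < nb_elements m')%N -> adj m' l k -> in_coarse_patch j l.
Proof.
move=> jn jk ln /adjP[x [xl xk]]; have [i i_n il] := child_exists nest ln.
rewrite (in_coarse_patch_child _ i_n il); apply/adjP; exists x.
by split; [exact: (child_sub nest i_n il)|exact: (child_sub nest jn jk)].
Qed.

Lemma sum_coarse_patch j (g : nat -> R) :
  \sum_(0 <= l < nb_elements m' | in_coarse_patch j l) g l =
  \sum_(0 <= i < nb_elements m | adj m i j)
    \sum_(embed m m' i <= l < embed m m' i.+1) g l.
Proof. by apply: sum_children => // i l; exact: in_coarse_patch_child. Qed.

Lemma patch_len_children j : patch_len m j =
  \sum_(0 <= l < nb_elements m' | in_coarse_patch j l) elt_len m' l.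
Proof.
rewrite sum_coarse_patch /patch_len big_nat_cond [RHS]big_nat_cond.
apply: eq_bigr => i /andP[/andP[_ i_n] _].
by rewrite sum_len_children.
Qed.

Lemma patch_mult_children j : patch_mult m j +
    \sum_(0 <= i < nb_elements m | adj m i j) (~~ kept i)%:R <=
  \sum_(0 <= l < nb_elements m' | in_coarse_patch j l) (elt_mult m' l)%:R.
Proof.
rewrite sum_coarse_patch /patch_mult -big_split /=.
rewrite big_nat_cond [leRHS]big_nat_cond.
apply: ler_sum => i /andP[/andP[_ i_n] _].
by rewrite -natrD -natr_sum ler_nat sum_mult_children.
Qed.

Lemma coarse_patch_connected j : (j < nb_elements m)%N ->
  connected (\bigcup_(l in
    [set l | (l < nb_elements m')%N && in_coarse_patch j l]) element m' l).
Proof.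
move=> jn; set A := (X in connected X).
have -> : A = \bigcup_(i in [set i | (i < nb_elements m)%N && adj m i j])
    (element m i `|` element m j).
  apply/seteqP; split=> [x [l /= /andP[ln /asboolP[i [i_n il ij]]] xl]|].
    by exists i; [rewrite /= i_n|left; exact: (child_sub nest i_n il)].
  have sub i' : (i' < nb_elements m)%N -> adj m i' j -> element m i' `<=` A.
    move=> i'n i'j y /(element_children nest i'n)[l il yl]; exists l => //=.
    by rewrite (child_lt nest i'n il) (in_coarse_patch_child _ i'n il).
  by move=> x [i /= /andP[i_n ij]] [|]; apply: sub => //; exact: adj_refl.
have [x xj] := element_nonempty jn.
apply: bigcup_connected; first by exists x => i _; right.
move=> i /= /andP[i_n /adjP ij].
by apply: connectedU => //; exact: element_connected.
Qed.

Lemma elements_closed (P : pred nat) :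
  closed (\bigcup_(l in [set l | (l < nb_elements m')%N && P l]) element m' l).
Proof.
apply: closed_bigcup.
  apply: (@sub_finite_set _ _ `I_(nb_elements m')); last exact: finite_II.
  by move=> l /= /andP[].
move=> l /= /andP[ln _]; apply: compact_closed; first exact: norm_hausdorff.
exact: element_compact.
Qed.

(** If the fine patch of the element [k] misses some fine element of the coarse
    patch, it misses one that meets an element of the fine patch.  Otherwise
    the fine patch and the union of the missed elements would be two disjoint
    closed sets covering the coarse patch, which is connected. *)
Lemma coarse_patch_neighbour j k l : (j < nb_elements m)%N -> child j k ->
  (l < nb_elements m')%N -> in_coarse_patch j l -> ~~ adj m' l k ->
  exists s i, [/\ (s < nb_elements m')%N, in_coarse_patch j s, ~~ adj m' s k,
    (i < nb_elements m')%N & adj m' i k /\ adj m' i s].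
Proof.
move=> jn jk ln jl lk.
have kn := child_lt nest jn jk.
pose A := \bigcup_(l in [set l | (l < nb_elements m')%N && in_coarse_patch j l])
  element m' l.
pose B := \bigcup_(l in [set l | (l < nb_elements m')%N && adj m' l k])
  element m' l.
pose C := \bigcup_(l in [set l | (l < nb_elements m')%N &&
  (in_coarse_patch j l && ~~ adj m' l k)]) element m' l.
have [[x [[i /= /andP[i_n ik] xi] [s /= /and3P[sn js sk] xs]]]|BC] :=
    pselect (B `&` C !=set0).
  by exists s, i; split => //; split => //; apply/adjP; exists x.
have BA : B `<=` A.
  move=> x [i /= /andP[i_n ik] xi]; exists i => //=.
  by rewrite i_n (adj_in_coarse_patch jn jk i_n ik).
have AB : B = A.
  apply: (coarse_patch_connected jn).
  - have [x xk] := element_nonempty kn; exists x; exists k => //=.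
    by rewrite kn adj_refl.
  - exists (~` C); first by apply: closed_openC; exact: elements_closed.
    apply/seteqP; split=> [x xB|x [[i /= /andP[i_n ij] xi] xC]].
      by split; [exact: BA|move=> xC; apply: BC; exists x].
    exists i => //=; rewrite i_n /=; apply/negPn/negP => ik.
    by apply: xC; exists i => //=; rewrite i_n ij ik.
  - exists B; first exact: elements_closed.
    by rewrite setIidr.
have [x xl] := element_nonempty ln; case: BC; exists x; split.
  by rewrite AB; exists l => //=; rewrite ln.
by exists l => //=; rewrite ln jl lk.
Qed.

(** The missed element next to the fine patch has, up to the factor
    [5 * kappa ^+ 3], at least the length of the fine patch: three steps between
    adjacent elements lead from it to any of the at most 5 elements there. *)
Lemma patch_len_shrinks j k l : (j < nb_elements m)%N -> child j k ->
  (l < nb_elements m')%N -> in_coarse_patch j l -> ~~ adj m' l k ->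
  (1 + 5 * kappa ^+ 3) * patch_len m' k <= 5 * kappa ^+ 3 * patch_len m j.
Proof.
move=> jn jk ln jl lk.
have kn := child_lt nest jn jk.
have k0 : 0 <= kappa by exact: le_trans kappa_ge1.
have [s [i [sn js sk i_n [ik si]]]] := coarse_patch_neighbour jn jk ln jl lk.
have len_ks : elt_len m' k <= kappa * (kappa * elt_len m' s).
  apply: le_trans (shape_ratio_adj sg shape' kn i_n _) _.
    by rewrite adj_sym.
  by rewrite ler_wpM2l//; exact: (shape_ratio_adj sg shape').
have patch_s : patch_len m' k <= 5 * kappa ^+ 3 * elt_len m' s.
  apply: le_trans (patch_len_le sg shape' k0 kn) _.
  rewrite exprS expr2 -!mulrA ler_wpM2l// ler_wpM2l//.
suff add_s : patch_len m' k + elt_len m' s <= patch_len m j.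
  have c0 : 0 <= 5 * kappa ^+ 3 by rewrite mulr_ge0// exprn_ge0.
  by move: patch_s (ler_wpM2l c0 add_s); set c := 5 * _; lra.
rewrite (patch_len_children j) /patch_len [leLHS]addrC.
rewrite [leRHS]big_mkcond.
rewrite [leRHS](bigD1_seq s) ?mem_index_iota ?iota_uniq//= js lerD2l.
rewrite big_mkcond [leRHS]big_mkcond /= big_seq_cond [leRHS]big_seq_cond.
apply: ler_sum => a.
rewrite mem_index_iota => /andP[an _]; case: ifP => ak.
  rewrite (adj_in_coarse_patch jn jk an ak).
  by case: eqP => // E; rewrite -E ak in sk.
by do 2 case: ifP => // _; rewrite ltW// elt_len_gt0.
Qed.

Lemma patch_len_stable j k : (j < nb_elements m)%N -> child j k ->
  (forall l, (l < nb_elements m')%N -> in_coarse_patch j l -> adj m' l k) ->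
  patch_len m' k = patch_len m j /\
  patch_mult m j + \sum_(0 <= i < nb_elements m | adj m i j) (~~ kept i)%:R <=
    patch_mult m' k.
Proof.
move=> jn jk all_adj.
have same (g : nat -> R) :
    \sum_(0 <= l < nb_elements m' | in_coarse_patch j l) g l =
    \sum_(0 <= l < nb_elements m' | adj m' l k) g l.
  rewrite big_nat_cond [RHS]big_nat_cond; apply: eq_bigl => l.
  case: (boolP (_ <= l < _)%N) => //= ln.
  by apply/idP/idP; [exact: all_adj|exact: adj_in_coarse_patch].
rewrite patch_len_children same; split => //.
by rewrite [patch_mult m' k]/patch_mult -same patch_mult_children.
Qed.

End patch_refinement.

(** * The modified mesh size *)

Section mesh_value.
Context (R : realType) (gamma : pwC2_path R) (p : nat) (kappa : R).
Context (kappa_ge1 : 1 <= kappa).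

(** The constant A; it is so much larger than all sums of multiplicities in a
    patch that the loss of length of a patch outweighs any loss of
    multiplicities. *)
Definition wt : R := (1 + 5 * kappa ^+ 3) * (10 * p.+1%:R + 1).

(** Value of the modified mesh size on the element with index [j]. *)
Definition mesh_value (m : mesh gamma p) j : R :=
  patch_len m j * (wt - patch_mult m j).

Lemma kappa3_ge0 : 0 <= 5 * kappa ^+ 3.
Proof. by rewrite mulr_ge0// exprn_ge0// (le_trans _ kappa_ge1). Qed.

Lemma wt_ge : 10 * p.+1%:R + 1 <= wt.
Proof.
by rewrite /wt -[leLHS]mul1r ler_wpM2r ?lerDl ?kappa3_ge0//.
Qed.

Lemma wt_gt1 : 1 < wt.
Proof. by apply: lt_le_trans wt_ge; rewrite ltrDr mulr_gt0. Qed.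

Context (sg : simple_path gamma).
Implicit Types m : mesh gamma p.

Lemma mesh_value_bounds m j : shape_ratio m <= kappa -> (j < nb_elements m)%N ->
  elt_len m j <= mesh_value m j <= 5 * kappa * wt * elt_len m j.
Proof.
move=> hk jn; have k0 : 0 <= kappa by exact: le_trans kappa_ge1.
have L1 := patch_len_ge jn; have L0 := patch_len_gt0 jn.
have L2 := patch_len_le sg hk k0 jn.
have N0 := patch_mult_ge0 m j; have N1 := patch_mult_le sg jn.
have w1 := wt_ge; have w2 := wt_gt1; apply/andP; split.
- apply: le_trans L1 _; rewrite /mesh_value -[leLHS]mulr1 ler_wpM2l ?(ltW L0)//.
  by lra.
- rewrite -mulrA (mulrC wt) mulrA -(mulrA 5).
  apply: ler_pM => //; rewrite ?(ltW L0)//; lra.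
Qed.

Lemma mesh_value_refinement m m' j k : nested m m' -> shape_ratio m' <= kappa ->
  (j < nb_elements m)%N -> child m m' j k ->
  mesh_value m' k <= mesh_value m j /\
  (forall i, (i < nb_elements m)%N -> adj m i j -> ~~ kept m m' i ->
   mesh_value m' k <= (1 - wt^-1) * mesh_value m j).
Proof.
move=> nest hk jn jk; have kn := child_lt nest jn jk.
have L0 := patch_len_gt0 jn; have L0' := patch_len_gt0 kn.
have N1 := patch_mult_le sg jn; have N0 := patch_mult_ge0 m j.
have N0' := patch_mult_ge0 m' k.
have w1 := wt_ge; have w2 := wt_gt1.
have winv : wt * wt^-1 = 1 by rewrite mulfV// gt_eqF// (lt_trans _ w2).
have winv0 : 0 < wt^-1 by rewrite invr_gt0 (lt_trans _ w2).
have V0 : 0 < mesh_value m j by rewrite /mesh_value mulr_gt0//; lra.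
have q_le : (1 - wt^-1) * mesh_value m j <= mesh_value m j.
  by rewrite ler_piMl ?(ltW V0)// gerBl ltW.
have part : wt - patch_mult m j - 1 <= (1 - wt^-1) * (wt - patch_mult m j).
  have := ler_wpM2l (ltW winv0) (_ : wt - patch_mult m j <= wt).
  by rewrite gerBl => /(_ N0); rewrite [_ * wt]mulrC winv mulrBl mul1r; lra.
case: (pselect (exists l, [/\ (l < nb_elements m')%N, in_coarse_patch m m' j l &
    ~~ adj m' l k])) => [[l [ln jl lk]]|stable].
- have shrink := patch_len_shrinks sg nest kappa_ge1 hk jn jk ln jl lk.
  suff contract : mesh_value m' k <= (1 - wt^-1) * mesh_value m j.
    by split; first exact: le_trans contract q_le.
  have le1 : mesh_value m' k <= patch_len m' k * wt.
    by rewrite /mesh_value ler_wpM2l ?(ltW L0')// gerBl.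
  have le2 : patch_len m' k * wt <= patch_len m j * (wt - (10 * p.+1%:R + 1)).
    have W0 : 0 <= 10 * p.+1%:R + 1 :> R by rewrite addr_ge0// mulr_ge0.
    move: (ler_wpM2r W0 shrink); rewrite /wt.
    by set c := 5 * _; set W := 10 * _ + 1; lra.
  apply: le_trans le1 (le_trans le2 _).
  by rewrite /mesh_value mulrCA ler_wpM2l ?(ltW L0)//; lra.
- have [l ln jl|LE NE] := patch_len_stable nest jn jk.
    by apply/negPn/negP => lk; apply: stable; exists l.
  pose S : R :=
    \sum_(0 <= i < nb_elements m | adj m i j) (~~ kept m m' i)%:R.
  rewrite -/S in NE; have S0 : 0 <= S by exact: sumr_ge0.
  rewrite /mesh_value LE; split=> [|i i_n ij ki].
    by rewrite ler_pM2l//; lra.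
  have S1 : 1 <= S.
    rewrite /S big_mkcond (bigD1_seq i) ?mem_index_iota ?iota_uniq//= ij ki.
    by rewrite lerDl sumr_ge0// => a _; case: ifP.
  by rewrite mulrCA ler_pM2l//; lra.
Qed.
End mesh_value.

(** * The modified mesh size as a function on the boundary *)

Section mesh_function.
Context (R : realType) (gamma : pwC2_path R) (p : nat).
Context (sg : simple_path gamma).
Implicit Types m : mesh gamma p.

(** All nodes including z_0, whether the path is closed or open. *)
Definition all_nodes m : set (plane R) :=
  [set node m j | j in [set j | (j <= nb_elements m)%N]].

Lemma all_nodes_negligible m :
  {ae arclength gamma, forall x, ~ all_nodes m x}.
Proof.
exists (all_nodes m).
have fin_nodes : finite_set (all_nodes m).
  apply: finite_image.
  exact: (sub_finite_set _ (finite_II (nb_elements m).+1)).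
split; last by move=> x /= /contrapT.
- apply: countable_measurable; last exact: finite_set_countable.
  by move=> x; apply: compact_measurable_plane; exact: compact_set1.
- apply: arclength_countable; apply: (@finite_set_countable R).
  apply: (@sub_finite_set _ _ [set node_param m j | j in `I_(nb_elements m).+1]);
    last by apply: finite_image; exact: finite_II.
  move=> t [/= + [j jn jt]]; rewrite in_itv /= => ht.
  have [<-|[_ ->]|[_ ->]] := sg (node_param_itv jn) ht jt.
  + by exists j.
  + by exists (nb_elements m); rewrite /= ?ltnSn ?node_param_last.
  + by exists 0%N.
Qed.

Lemma element_unique m i j x : (i < nb_elements m)%N -> (j < nb_elements m)%N ->
  ~ all_nodes m x -> element m i x -> element m j x -> i = j.
Proof.
move=> i_n jn xn /elementP[s hs sx] /elementP[t ht tx].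
have no k : (k <= nb_elements m)%N -> s <> node_param m k.
  by move=> kn sk; apply: xn; exists k => //; rewrite /node -sk.
have hs' := element_param_itv i_n hs; have ht' := element_param_itv jn ht.
have [E|[E _]|[E _]] := sg hs' ht' (etrans sx (esym tx)).
- move: hs ht; rewrite -E => /andP[s1 s2] /andP[s3 s4].
  case: (ltngtP i j) => // [ij|ji].
  + case: (no j (ltnW jn)); apply/eqP; rewrite eq_le s3 andbT.
    by apply: le_trans s2 _; rewrite node_param_le// ltnW.
  + case: (no i (ltnW i_n)); apply/eqP; rewrite eq_le s1 andbT.
    by apply: le_trans s4 _; rewrite node_param_le// ltnW.
- by case: (no 0%N).
- by case: (no (nb_elements m)) => //; rewrite node_param_last.
Qed.

Lemma mesh_width_element m j x : (j < nb_elements m)%N -> ~ all_nodes m x ->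
  element m j x -> mesh_width m x = elt_len m j.
Proof.
move=> jn xn xj; rewrite /mesh_width.
case: xgetP => [_ _ [[i i_n <-] xi]|/(_ (element m j)) []]; last first.
  by split => //; exists j.
by rewrite (element_unique i_n jn xn xi xj) param_length_element.
Qed.

Lemma mesh_width_outside m x :
  (forall j, (j < nb_elements m)%N -> ~ element m j x) -> mesh_width m x = 0.
Proof.
move=> xout; rewrite /mesh_width.
case: xgetP => [_ _ [[i i_n <-] /(xout i i_n)]//|_].
by rewrite /param_length preimage_set0 setI0 measure0.
Qed.

Context (kappa : R).

(** The modified mesh size as a function on the plane; the values at the nodes
    are irrelevant. *)
Definition mesh_fun m (x : plane R) : R :=
  \sum_(0 <= j < nb_elements m) mesh_value kappa m j * \1_(element m j) x.

Lemma mesh_fun_element m j x : (j < nb_elements m)%N -> ~ all_nodes m x ->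
  element m j x -> mesh_fun m x = mesh_value kappa m j.
Proof.
move=> jn xn xj; rewrite /mesh_fun (bigD1_seq j) ?mem_index_iota ?iota_uniq//=.
rewrite indicE mem_set// mulr1 big_seq_cond big1 ?addr0// => i.
rewrite mem_index_iota => /andP[/andP[_ i_n] ij]; rewrite indicE memNset ?mulr0//.
by move=> xi; rewrite (element_unique i_n jn xn xi xj) eqxx in ij.
Qed.

Lemma mesh_fun_outside m x :
  (forall j, (j < nb_elements m)%N -> ~ element m j x) -> mesh_fun m x = 0.
Proof.
move=> xout; rewrite /mesh_fun big_seq_cond big1// => i.
rewrite mem_index_iota => /andP[/andP[_ i_n] _].
by rewrite indicE memNset ?mulr0//; exact: xout.
Qed.

Lemma mesh_fun_Linfty m :
  exists g : Linfty gamma, {ae arclength gamma, forall x, g x = mesh_fun m x}.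
Proof.
apply: (@Linfty_of_bounded _ _ (mesh_fun m)
  (\sum_(0 <= j < nb_elements m) `|mesh_value kappa m j|)).
- have -> : mesh_fun m = fun x => \sum_(j < nb_elements m)
      mesh_value kappa m j * \1_(element m j) x.
    by apply/funext => x; rewrite /mesh_fun big_mkord.
  apply: measurable_sum => j; apply: measurable_funM => //.
  apply: measurable_indic; apply: compact_measurable_plane.
  exact: element_compact.
- move=> x; apply: le_trans (ler_norm_sum _ _ _) _; apply: ler_sum => j _.
  by rewrite normrM ler_piMr// indicE; case: (_ \in _); rewrite ?normr1 ?normr0.
Qed.

Lemma mesh_fun_bounds m x : 1 <= kappa -> shape_ratio m <= kappa ->
  ~ all_nodes m x ->
  (5 * kappa * wt p kappa)^-1 * mesh_width m x <= mesh_fun m x <=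
  5 * kappa * wt p kappa * mesh_width m x.
Proof.
move=> k1 hk xn; have w1 := wt_gt1 p k1.
have C1 : 1 <= 5 * kappa * wt p kappa.
  by rewrite mulr_ege1 ?(ltW w1)// mulr_ege1// ler1n.
case: (pselect (exists2 j, (j < nb_elements m)%N & element m j x)) =>
  [[j jn xj]|xout].
- rewrite (mesh_width_element jn xn xj) (mesh_fun_element jn xn xj).
  have /andP[h1 ->] := mesh_value_bounds k1 sg hk jn; rewrite andbT.
  apply: le_trans h1; rewrite ler_piMl ?(ltW (elt_len_gt0 jn))//.
  by rewrite invf_le1// (lt_le_trans _ C1).
- have xout' j : (j < nb_elements m)%N -> ~ element m j x.
    by move=> jn xj; apply: xout; exists j.
  by rewrite mesh_width_outside// mesh_fun_outside// !mulr0 lexx.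
Qed.

Lemma mesh_fun_refinement m m' x : 1 <= kappa -> nested m m' ->
  shape_ratio m' <= kappa -> ~ all_nodes m x -> ~ all_nodes m' x ->
  mesh_fun m' x <= mesh_fun m x /\
  (bracket_patch m' (brackets m' `\` brackets m) x ->
   mesh_fun m' x <= (1 - (wt p kappa)^-1) * mesh_fun m x).
Proof.
move=> k1 nest hk xn xn'.
case: (pselect (exists2 k, (k < nb_elements m')%N & element m' k x)) =>
  [[k kn xk]|xout].
- have [j jn jk] := child_exists nest kn.
  have xj := child_sub nest jn jk xk.
  rewrite (mesh_fun_element jn xn xj) (mesh_fun_element kn xn' xk).
  have [h1 h2] := mesh_value_refinement k1 sg nest hk jn jk.
  split => //; rewrite /bracket_patch (bracket_union_fine sg nest).
  move=> [_ [[l ln <-] [y [yl [i /andP[i_n ki] yi]]]] xl].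
  apply: (h2 i) => //; apply/adjP; exists y; split => //.
  rewrite (element_unique ln kn xn' xl xk) in yl.
  exact: (child_sub nest jn jk).
- have out' k : (k < nb_elements m')%N -> ~ element m' k x.
    by move=> kn xk; apply: xout; exists k.
  rewrite [mesh_fun m' x]mesh_fun_outside// mesh_fun_outside ?mulr0.
    by split.
  move=> j jn /(element_children nest jn)[k jk]; apply: out'.
  exact: (child_lt nest jn jk).
Qed.

End mesh_function.

Theorem proposition4p2 (R : realType) (gamma : pwC2_path R) (p : nat)
    (kappa_max : R) (kappa_max_ge1 : 1 <= kappa_max) :
  exists C_wt q_ctr : R, [/\ 0 < C_wt, 0 < q_ctr < 1 &
    forall (cl : bool) (Omega Gamma : set (plane R)),
    boundary_setting cl Omega Gamma gamma ->
    forall ref : mesh gamma p -> set (plane R) -> mesh gamma p,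
    refinement_strategy cl ref ->
    forall m0 : mesh gamma p,
    (cl -> forall T, elements m0 T ->
      (arclength gamma T <= arclength gamma Gamma * (4^-1)%:E)%E) ->
    (forall m, refinements cl ref m0 m -> shape_ratio m <= kappa_max) ->
    exists htilde : mesh gamma p -> Linfty gamma,
    forall m m' : mesh gamma p,
    refinements cl ref m0 m -> refinements cl ref m m' ->
    [/\ {ae arclength gamma, forall x,
          C_wt^-1 * mesh_width m x <= htilde m x <= C_wt * mesh_width m x},
        {ae arclength gamma, forall x, htilde m' x <= htilde m x},
        {ae arclength gamma, forall x,
          bracket_patch m' (brackets m' `\` brackets m) x ->
          htilde m' x <= q_ctr * htilde m x} &
        bracket_patch m' (brackets m' `\` brackets m) =
        bracket_patch m (brackets m `\` brackets m')]].
Proof.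
have w1 := wt_gt1 p kappa_max_ge1; have w0 := lt_trans ltr01 w1.
exists (5 * kappa_max * wt p kappa_max), (1 - (wt p kappa_max)^-1); split.
- by rewrite mulr_gt0// mulr_gt0// (lt_le_trans ltr01).
- by rewrite subr_gt0 invf_lt1// w1 gtrBl invr_gt0 w0.
move=> cl Omega Gamma bs ref rs m0 _ shape.
have sg := boundary_simple_path bs.
have [htilde hP] := choice (@mesh_fun_Linfty _ gamma p kappa_max).
exists htilde => m m' r0m rmm'.
have nest := refinements_nested bs rs rmm'.
have hm := shape m r0m; have hm' := shape m' (refinements_trans r0m rmm').
have [nm nm'] := (all_nodes_negligible sg m, all_nodes_negligible sg m').
split; last exact: patch_changed.
- apply: filterS2 (hP m) nm => x -> xn; exact: mesh_fun_bounds.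
- apply: filterS2 (filterI (hP m) nm) (filterI (hP m') nm') => x [-> xn] [-> xn'].
  by have [] := mesh_fun_refinement sg kappa_max_ge1 nest hm' xn xn'.
- apply: filterS2 (filterI (hP m) nm) (filterI (hP m') nm') => x [-> xn] [-> xn'].
  by have [_] := mesh_fun_refinement sg kappa_max_ge1 nest hm' xn xn'.
Qed.
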